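(* Let $r \geq 2$. There exists a family $\mathcal{H}^r$ of graphs such that every $H \in \mathcal{H}^r$ is $(r+1)$-critical and satisfies $\operatorname{pw}(H) = \operatorname{tw}(H) = r$, and for every $s \in \mathbb{N}$ there exists $H \in \mathcal{H}^r$ with $s \leq |V(H)| \leq s + r$.
   Context: A graph $G$ is $t$-critical if its chromatic number is $\chi(G) = t$ and $\chi(G - v) = t - 1$ for every vertex $v \in V(G)$. $\operatorname{pw}$ and $\operatorname{tw}$ denote pathwidth and treewidth. *)

(* Defs.v *)
From mathcomp Require Import all_boot.
From mathcomp Require Import boolp.

Set Implicit Arguments.
Unset Strict Implicit.
Unset Printing Implicit Defensive.

Record sgraph := SGraph {
  vertex :> finType;
  edge : rel vertex;
  edge_sym : symmetric edge;
  edge_irrefl : irreflexive edge }.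

Section Induced.
Variables (G : sgraph) (S : {set G}).

Definition induced_edge : rel {x : G | x \in S} :=
  fun x y => edge (val x) (val y).

Fact induced_edge_sym : symmetric induced_edge.
Proof. by move=> x y; apply: edge_sym. Qed.

Fact induced_edge_irrefl : irreflexive induced_edge.
Proof. by move=> x; apply: edge_irrefl. Qed.

Definition induced : sgraph := SGraph induced_edge_sym induced_edge_irrefl.

End Induced.

Definition delete_vertex (G : sgraph) (v : G) : sgraph := induced [set~ v].

Section PathGraph.
Variable n : nat.

Definition path_edge : rel 'I_n := fun i j => (i.+1 == j) || (j.+1 == i).

Fact path_edge_sym : symmetric path_edge.
Proof. by move=> i j; rewrite /path_edge orbC. Qed.

Fact path_edge_irrefl : irreflexive path_edge.
Proof. by move=> i; rewrite /path_edge orbb gtn_eqF. Qed.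

Definition path_graph : sgraph := SGraph path_edge_sym path_edge_irrefl.

End PathGraph.

Definition colorable (G : sgraph) (k : nat) : bool :=
  [exists f : {ffun G -> 'I_k},
    [forall x, forall y, edge x y ==> (f x != f y)]].

Fact colorable_ex (G : sgraph) : exists k, colorable G k.
Proof.
exists #|G|; apply/existsP; exists [ffun x => enum_rank x].
apply/forallP => x; apply/forallP => y; apply/implyP => xy.
rewrite !ffunE (inj_eq enum_rank_inj).
by apply: contraTneq xy => ->; rewrite edge_irrefl.
Qed.

Definition chromatic_number (G : sgraph) : nat := ex_minn (colorable_ex G).

Definition critical (t : nat) (G : sgraph) : Prop :=
  chromatic_number G = t /\
  forall v : G, chromatic_number (delete_vertex v) = t.-1.

(* The graph on no vertices satisfies [connected] but not [is_tree]. *)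
Definition connected (G : sgraph) : Prop :=
  forall x y : G, connect (@edge G) x y.

Definition acyclic (G : sgraph) : Prop :=
  forall c : seq G, 2 < size c -> ~ ucycle (@edge G) c.

Definition is_tree (T : sgraph) : Prop :=
  [/\ 0 < #|T|, connected T & acyclic T].

(* Only the axioms on the bags: that [T] is a tree or a path is required
   separately, in [has_tree_decomp] and [has_path_decomp]. *)
Definition decomposition (G T : sgraph) (B : T -> {set G}) : Prop :=
  [/\ forall v : G, exists t : T, v \in B t,
      forall u v : G, edge u v -> exists t : T, (u \in B t) && (v \in B t)
    & forall v : G, connected (induced [set t | v \in B t])].

(* Because of the truncated predecessor, the graph on no vertices gets width 0
   instead of the usual -1; no other graph is affected. *)
Definition width (G T : sgraph) (B : T -> {set G}) : nat :=
  (\max_(t : T) #|B t|).-1.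

Definition has_tree_decomp (G : sgraph) (k : nat) : Prop :=
  exists (T : sgraph) (B : T -> {set G}),
    [/\ is_tree T, decomposition B & width B = k].

Definition has_path_decomp (G : sgraph) (k : nat) : Prop :=
  exists (n : nat) (B : path_graph n.+1 -> {set G}),
    decomposition B /\ width B = k.

Fact decomposition_setT (G : sgraph) :
  decomposition (fun _ : path_graph 1 => [set: G]).
Proof.
split=> [v|u v _|v].
- by exists ord0; rewrite inE.
- by exists ord0; rewrite !inE.
- by move=> x y; rewrite (_ : x = y) ?connect0 //; apply/val_inj; rewrite !ord1.
Qed.

Fact is_tree_path1 : is_tree (path_graph 1).
Proof.
split=> [|x y|c c_gt2]; first by rewrite card_ord.
  by rewrite (ord1 x) (ord1 y) connect0.
case/andP=> _ /card_uniqP c_card.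
by have := max_card (mem c); rewrite c_card card_ord leqNgt (ltn_trans _ c_gt2).
Qed.

Fact tree_decomp_ex (G : sgraph) : exists k, `[< has_tree_decomp G k >].
Proof.
exists (width (fun _ : path_graph 1 => [set: G])); apply/asboolP.
exists (path_graph 1), (fun _ => [set: G]).
by split=> //; [apply: is_tree_path1 | apply: decomposition_setT].
Qed.

Fact path_decomp_ex (G : sgraph) : exists k, `[< has_path_decomp G k >].
Proof.
exists (width (fun _ : path_graph 1 => [set: G])); apply/asboolP.
exists 0, (fun _ => [set: G]).
by split=> //; apply: decomposition_setT.
Qed.

Definition treewidth (G : sgraph) : nat := ex_minn (tree_decomp_ex G).

Definition pathwidth (G : sgraph) : nat := ex_minn (path_decomp_ex G).

(* Main.v *)
(** Witnesses: join an odd cycle with a clique on [r - 2] vertices, i.e. cone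
    [r - 2] times over the cycle. Each cone raises the chromatic number and the
    width by one and preserves criticality, and every second integer from
    [r + 1] on is the size of a witness. The lower bound on the widths is
    [chi <= tw + 1]: colour the bags greedily, growing a subtree of the
    decomposition tree; by acyclicity the already coloured vertices of a new bag
    all lie in the neighbouring bag, where they have distinct colours. *)

Require Import Defs.
From mathcomp Require Import all_boot.
From mathcomp Require Import boolp zify.

Set Implicit Arguments.
Unset Strict Implicit.
Unset Printing Implicit Defensive.

(** * Colourings *)

Lemma colorableP (G : sgraph) k :
  reflect (exists2 c : G -> nat, forall x, c x < k &
             forall x y, edge x y -> c x != c y)
          (colorable G k).
Proof.
apply: (iffP existsP) => [[f /forallP fP]|[c ck cP]].
  exists (fun x => nat_of_ord (f x)) => // x y xy; apply: contraTneq (fP x) => fxy.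
  by apply/forallPn; exists y; rewrite xy /= negbK -val_eqE /= fxy.
exists [ffun x => Ordinal (ck x)]; apply/forallP => x; apply/forallP => y.
by apply/implyP => /cP; rewrite !ffunE -val_eqE.
Qed.

Lemma colorable_mono (G : sgraph) k l : k <= l -> colorable G k -> colorable G l.
Proof.
move=> kl /colorableP[c ck cP]; apply/colorableP; exists c => // x.
exact: leq_trans (ck x) kl.
Qed.

Lemma chromatic_number_leq (G : sgraph) k :
  (chromatic_number G <= k) = colorable G k.
Proof.
rewrite /chromatic_number; case: ex_minnP => m Gm m_min.
by apply/idP/idP => [mk|/m_min//]; apply: colorable_mono mk Gm.
Qed.

(** Colourings of [G - v] become functions on all of [G] with an arbitrary value at [v]. This keeps
    the subtype behind [delete_vertex] out of the criticality arguments. *)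
Lemma colorable_deleteP (G : sgraph) (v : G) k :
  reflect (exists2 c : G -> nat, forall x, x != v -> c x < k &
             forall x y, x != v -> y != v -> edge x y -> c x != c y)
          (colorable (delete_vertex v) k).
Proof.
apply: (iffP (colorableP _ _)) => [[c ck cP]|[c ck cP]]; last first.
  have valNv (x : delete_vertex v) : val x != v by have := valP x; rewrite !inE.
  exists (fun x => c (val x)) => [x|x y xy]; first exact/ck/valNv.
  by apply: cP => //; apply: valNv.
have inD x : x != v -> x \in [set~ v] by rewrite !inE.
pose sub x : option {x : G | x \in [set~ v]} := insub x.
have subE x xv : sub x = Some (Sub x (inD x xv)) by apply: insubT.
exists (fun x => if sub x is Some x' then c x' else 0) => [x xv|x y xv yv xy].
  by rewrite subE.
by rewrite !subE; apply: cP.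
Qed.

Lemma colorable_undelete (G : sgraph) (v : G) k :
  colorable (delete_vertex v) k -> colorable G k.+1.
Proof.
case/colorable_deleteP=> c ck cP; apply/colorableP.
exists (fun x => if x == v then k else c x) => [x|x y xy].
  by case: ifPn => // /ck /leqW.
case: (eqVneq x v) xy => [->|xv] xy; case: (eqVneq y v) xy => [->|yv] xy.
- by rewrite edge_irrefl in xy.
- by rewrite gtn_eqF ?ck.
- by rewrite ltn_eqF ?ck.
- exact: cP.
Qed.

(** Giving a deleted vertex a fresh colour shows that deletion lowers the chromatic number by at
    most one, so upper bounds on the graphs [G - v] suffice. *)
Lemma criticalI (G : sgraph) t :
  ~~ colorable G t -> colorable G t.+1 ->
  (forall v : G, colorable (delete_vertex v) t) -> critical t.+1 G.
Proof.
rewrite -!chromatic_number_leq -ltnNge => tG Gt delG.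
have chi_G : chromatic_number G = t.+1 by apply/eqP; rewrite eqn_leq Gt.
split=> // v; apply/eqP; rewrite eqn_leq chromatic_number_leq delG /=.
rewrite -ltnS -chi_G chromatic_number_leq (@colorable_undelete _ v) //.
by rewrite -chromatic_number_leq.
Qed.

(** * Trees and the bound [chi <= tw + 1] *)

(** A simple path from [t] to [s] that avoids the edge [st] closes up with this edge to a cycle. *)
Lemma acyclic_bridge (T : sgraph) (s t : T) :
  acyclic T -> edge s t ->
  ~~ connect (fun x y => edge x y && ([set x; y] != [set s; t])) t s.
Proof.
move=> acT st; apply/negP => /connectP[p0 p0P].
case/shortenP: p0P => p pP p_uniq _ s_last.
apply: (acT (t :: p)).
  (* The cycle has at least three vertices: an empty [p] would make [st] a loop, and a single step
     would use the excluded edge. *)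
  case: p pP s_last {p_uniq} => [|x [|y p]] //= => [_ ts|].
    by rewrite ts edge_irrefl in st.
  by move=> /andP[/andP[_ tx] _] sx; rewrite -sx setUC eqxx in tx.
apply/andP; split=> //=; rewrite rcons_path -s_last st andbT.
by apply: sub_path pP => x y /andP[].
Qed.

Lemma connect_induced (G : sgraph) (S : {set G}) (x y : induced S) :
  connect (@edge (induced S)) x y ->
  connect (fun a b : G => [&& edge a b, a \in S & b \in S]) (val x) (val y).
Proof.
case/connectP=> p; elim: p x => [|z p IHp] x /= => [_ ->|/andP[xz zp] y_last].
  exact: connect0.
apply: connect_trans (IHp z zp y_last); apply: connect1.
by rewrite (valP x) (valP z) !andbT.
Qed.

Lemma exists_boundary_edge (T : sgraph) (S : {set T}) x y :
  connected T -> x \in S -> y \notin S ->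
  exists s t, [/\ edge s t, s \in S & t \notin S].
Proof.
move=> conT xS yS; have /connectP[p pP y_last] := conT x y.
elim: p x xS pP y_last => [|z p IHp] x xS /= => [_ yx|/andP[xz zp] y_last].
  by rewrite yx xS in yS.
have [zS|zS] := boolP (z \in S); first exact: (IHp z).
by exists x, z.
Qed.

(** The vertices of [D :\: A] receive distinct colours from those that [c] does not use on
    [A :&: D]. There are enough of them, since [c] uses exactly [#|A :&: D|] colours there and
    [#|D| <= #|C|]. *)
Lemma extend_injective (V C : finType) (c : V -> C) (A D : {set V}) :
  {in A &, injective c} -> #|D| <= #|C| ->
  exists2 c' : V -> C, {in D &, injective c'} &
    forall v, (v \notin D) || (v \in A) -> c' v = c v.
Proof.
move=> c_inj DC; pose F := enum (~: (c @: (A :&: D))); pose N := enum (D :\: A).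
have cardF : #|D :\: A| <= size F.
  rewrite /F -cardE [#|~: _|]cardsCs setCK card_in_imset.
    by rewrite cardsD setIC leq_sub2r.
  by move=> x y /setIP[xA _] /setIP[yA _]; apply: c_inj.
have idxN v : v \in D :\: A -> index v N < size F.
  by move=> vDA; apply: leq_trans cardF; rewrite cardE index_mem mem_enum.
have nthF z v : v \in D :\: A -> nth z F (index v N) \notin c @: (A :&: D).
  by move=> vDA; have := mem_nth z (idxN v vDA); rewrite mem_enum inE.
exists (fun v => if v \in D :\: A then nth (c v) F (index v N) else c v).
  move=> x y xD yD; case: ifPn => xDA; case: ifPn => yDA.
  - rewrite (set_nth_default (c x) (c y)) ?idxN //.
    move/eqP; rewrite nth_uniq ?idxN ?enum_uniq // => /eqP.
    by apply: (index_inj x); rewrite mem_enum.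
  - move=> xy; have := nthF (c x) x xDA; rewrite xy imset_f // inE yD andbT.
    by move: yDA; rewrite inE yD andbT negbK.
  - move=> xy; have := nthF (c y) y yDA; rewrite -xy imset_f // inE xD andbT.
    by move: xDA; rewrite inE xD andbT negbK.
  - move: xDA yDA; rewrite !inE xD yD !andbT !negbK; exact: c_inj.
by move=> v; rewrite inE; case: (v \in D); case: (v \in A).
Qed.

Section GreedyBags.
Variables (G T : sgraph) (B : T -> {set G}) (k : nat).
Hypotheses (treeT : is_tree T) (decB : decomposition B).
Hypothesis cardB : forall t, #|B t| <= k.+1.

(** If [v] were missing from [B s], the nodes whose bags contain [v] would join [t] to [x] while
    avoiding [s], and [S] would join [x] to [s] while avoiding [t]. Together these walks bypass the
    bridge [st]. *)
Lemma separated_bags (S : {set T}) s t x v :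
  (forall y z, y \in S -> z \in S ->
     connect (fun a b => [&& edge a b, a \in S & b \in S]) y z) ->
  edge s t -> s \in S -> t \notin S ->
  x \in S -> v \in B x -> v \in B t -> v \in B s.
Proof.
move=> conS st sS tS xS vx vt; apply/negPn/negP => vs.
have [_ _ acT] := treeT; have [_ _ conB] := decB.
have /negP[] := acyclic_bridge acT st.
have inBv y : v \in B y -> y \in [set u | v \in B u] by rewrite inE.
have := connect_induced (conB v (Sub t (inBv t vt)) (Sub x (inBv x vx))).
rewrite !SubK => tx; apply: (@connect_trans _ _ x).
  apply: connect_sub tx => a b /and3P[ab]; rewrite !inE => va vb.
  apply: connect1; rewrite ab /=; apply: contraNneq vs => /setP/(_ s).
  by rewrite !inE eqxx /= => /orP[] /eqP ->.
apply: connect_sub (conS x s xS sS) => a b /and3P[ab aS bS].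
apply: connect1; rewrite ab /=; apply: contraNneq tS => /setP/(_ t).
by rewrite !inE eqxx orbT => /orP[] /eqP ->.
Qed.

(** Injectivity on each bag is stronger than properness on the vertices covered so far, and it is
    what lets the colouring of one bag extend to the next. Connectedness of [S] is carried along for
    [separated_bags]. *)
Lemma greedy_bags n : 0 < n <= #|T| ->
  exists S : {set T}, [/\ #|S| = n,
    forall y z, y \in S -> z \in S ->
      connect (fun a b => [&& edge a b, a \in S & b \in S]) y z &
    exists c : G -> 'I_k.+1, forall t, t \in S -> {in B t &, injective c}].
Proof.
have [T_gt0 conT _] := treeT.
elim: n => [//|[_ _|n IHn /=]].
  have /card_gt0P[r _] := T_gt0; exists [set r]; split; first exact: cards1.
    by move=> y z /set1P-> /set1P->; apply: connect0.
  (* The first bag is coloured by extending from the empty set, where a constant map is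
     injective. *)
  have inj0 : {in (set0 : {set G}) &, injective (fun=> ord0 : 'I_k.+1)}.
    by move=> x y; rewrite inE.
  have [|c c_inj _] := @extend_injective _ _ _ _ (B r) inj0.
    by rewrite card_ord.
  by exists c => t /set1P->.
move=> nT; have [|S [cardS conS [c c_inj]]] := IHn; first exact: ltnW.
have [x xS] : exists x, x \in S by apply/card_gt0P; rewrite cardS.
have [y yS] : exists y, y \notin S.
  apply/existsP; rewrite -negb_forall; apply: contraL nT => /forallP inS.
  by rewrite -leqNgt -cardS subset_leq_card //; apply/subsetP.
have [s [t [st sS tS]]] := exists_boundary_edge conT xS yS.
exists (t |: S); split; first by rewrite cardsU1 tS cardS.
  have symR : connect_sym (fun a b => [&& edge a b, a \in t |: S & b \in t |: S]).
    by apply: sym_connect_sym => a b; rewrite edge_sym andbA andbAC andbA.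
  suff to_s a : a \in t |: S ->
      connect (fun a b => [&& edge a b, a \in t |: S & b \in t |: S]) s a.
    by move=> a b /to_s sa /to_s; apply: connect_trans; rewrite symR.
  case/setU1P=> [->|aS]; first by apply: connect1; rewrite st !inE sS eqxx orbT.
  apply: connect_sub (conS s a sS aS) => d e /and3P[de dS eS].
  by apply: connect1; rewrite de !inE dS eS !orbT.
(* Only the colours on [B t :\: B s] change. By [separated_bags] this set meets no bag of [S], so
   the old bags keep their colours. *)
have [|c' c'_inj c'E] := @extend_injective _ _ _ _ (B t) (c_inj s sS).
  by rewrite card_ord.
exists c' => z /setU1P[->//|zS] u v uz vz.
have c'E' w : w \in B z -> c' w = c w.
  move=> wz; apply: c'E; case: (boolP (w \in B t)) => //= wt.
  exact: (separated_bags conS st sS tS zS).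
by rewrite !c'E' //; apply: c_inj zS _ _ uz vz.
Qed.

(** Once [S] is all of [T], the ends of any edge share a bag, on which the colouring is
    injective. *)
Lemma colorable_bags : colorable G k.+1.
Proof.
have [T_gt0 _ _] := treeT; have [_ edgeB _] := decB.
have [|S [cardS _ [c c_inj]]] := @greedy_bags #|T|; first by rewrite T_gt0 /=.
have inS t : t \in S.
  suff /eqP-> : S == setT by rewrite inE.
  by rewrite eqEcard subsetT cardsT cardS leqnn.
apply/colorableP; exists (fun v => nat_of_ord (c v)) => // u v uv.
have [t /andP[ut vt]] := edgeB u v uv.
apply: contraTneq uv => /val_inj /(c_inj t (inS t) u v ut vt) ->.
by rewrite edge_irrefl.
Qed.

End GreedyBags.

Lemma chromatic_number_treewidth (G : sgraph) :
  chromatic_number G <= (treewidth G).+1.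
Proof.
rewrite chromatic_number_leq /treewidth.
case: ex_minnP => _ /asboolP[T [B [treeT decB <-]]] _.
apply: colorable_bags treeT decB _ => t.
exact: leq_trans (leq_bigmax t) (leqSpred _).
Qed.

(** * Path decompositions *)

Lemma convex_connected n (S : {set path_graph n}) :
  (forall i j l : path_graph n,
     i <= l <= j -> i \in S -> j \in S -> l \in S) ->
  connected (induced S).
Proof.
move=> convS.
suff up d (x y : induced S) : val (val y) = val (val x) + d ->
    connect (@edge (induced S)) x y.
  move=> x y; case: (leqP (val (val x)) (val (val y))) => xy.
    by apply: (up (val (val y) - val (val x))); rewrite subnKC.
  rewrite (sym_connect_sym (@edge_sym _)).
  by apply: (up (val (val x) - val (val y))); rewrite subnKC // ltnW.
elim: d x => [|d IHd] x.
  rewrite addn0 => yx; suff -> : x = y by apply: connect0.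
  by apply/val_inj/val_inj.
move=> yx; have lt_n : (val (val x)).+1 < n.
  by apply: leq_ltn_trans (ltn_ord (val y)); rewrite /= in yx *; lia.
have zS : (Ordinal lt_n : path_graph n) \in S.
  apply: (convS (val x) (val y)); [|exact: valP..].
  by rewrite /= in yx *; lia.
apply: (@connect_trans _ _ (Sub (Ordinal lt_n : path_graph n) zS)).
  apply: connect1.
  by rewrite /= /induced_edge /= /path_edge /= eqxx.
by apply: IHd; rewrite /= in yx *; lia.
Qed.

(** The two neighbours of the greatest vertex on a cycle would both have to be its predecessor, yet
    they are distinct entries of the cycle. *)
Lemma path_graph_acyclic n : acyclic (path_graph n).
Proof.
move=> c c_gt2 /andP[c_cycle c_uniq].
have [x0 x0c] : exists x, x \in c.
  by case: c c_gt2 {c_cycle c_uniq} => // x c _; exists x; rewrite inE eqxx.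
have [x xc x_max] := @arg_maxnP _ x0 (mem c) (fun i : path_graph n => val i) x0c.
have [i c' cE] := rot_to xc.
move: c_gt2 c_cycle c_uniq; rewrite -(size_rot i) -(rot_cycle i) -(rot_uniq i).
have {}x_max y : y \in x :: c' -> val y <= val x.
  by rewrite -cE mem_rot => /x_max.
rewrite cE; case: c' x_max {cE} => [|y c'] // x_max.
case/lastP: c' x_max => [//|c' z] x_max _ /=.
rewrite rcons_path last_rcons => /andP[xy /andP[_ zx]] /and3P[_ yc' _].
have yM : val y <= val x by apply: x_max; rewrite !inE eqxx orbT.
have zM : val z <= val x.
  by apply: x_max; rewrite !inE mem_rcons inE eqxx !orbT.
case/negP: yc'; suff -> : y = z by rewrite mem_rcons inE eqxx.
by apply: val_inj; move: xy zx yM zM; rewrite /path_edge /=; lia.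
Qed.

Lemma path_graph_tree n : is_tree (path_graph n.+1).
Proof.
split; [by rewrite card_ord| |exact: path_graph_acyclic] => x y.
have convT : connected (induced [set: path_graph n.+1]).
  by apply: convex_connected => *; rewrite inE.
have := connect_induced (convT (Sub x (in_setT x)) (Sub y (in_setT y))).
rewrite !SubK; apply: connect_sub => a b /and3P[ab _ _]; exact: connect1.
Qed.

Lemma treewidth_pathwidth (G : sgraph) : treewidth G <= pathwidth G.
Proof.
rewrite /pathwidth; case: ex_minnP => _ /asboolP[n [B [decB <-]]] _.
rewrite /treewidth; case: ex_minnP => m _; apply; apply/asboolP.
by exists (path_graph n.+1), B; split=> //; apply: path_graph_tree.
Qed.

(** A form of path decomposition that passes to cones without comparing induced
    subgraphs. *)
Definition interval_layout (G : sgraph) (w : nat) : Prop :=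
  exists n (B : nat -> {set G}),
    [/\ forall v, exists2 t, t <= n & v \in B t,
       forall u v, edge u v -> exists2 t, t <= n & (u \in B t) && (v \in B t),
       forall v i j l, i <= l <= j -> v \in B i -> v \in B j -> v \in B l
     & forall t, #|B t| <= w.+1].

Lemma pathwidth_layout (G : sgraph) w : interval_layout G w -> pathwidth G <= w.
Proof.
case=> n [B [B_v B_e B_conv B_card]].
pose B' (t : path_graph n.+1) := B (val t).
have decB' : decomposition B'.
  split=> [v|u v uv|v].
  - by have [t tn vt] := B_v v; exists (Ordinal (tn : t < n.+1)).
  - by have [t tn uvt] := B_e u v uv; exists (Ordinal (tn : t < n.+1)).
  - by apply: convex_connected => i j l; rewrite !inE; apply: B_conv.
rewrite /pathwidth; case: ex_minnP => m _ /(_ (width B')) m_min.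
apply: leq_trans (m_min _) _; first by apply/asboolP; exists n, B'.
have : \max_t #|B' t| <= w.+1 by apply/bigmax_leqP => t _; apply: B_card.
by rewrite /width; lia.
Qed.

(** * Cones *)

Section Cone.
Variable G : sgraph.

Definition cone_edge : rel (option G) := fun x y =>
  match x, y with
  | Some u, Some v => edge u v
  | None, None => false
  | _, _ => true
  end.

Fact cone_edge_sym : symmetric cone_edge.
Proof. by case=> [u|] [v|] //=; apply: edge_sym. Qed.

Fact cone_edge_irrefl : irreflexive cone_edge.
Proof. by case=> [u|] //=; apply: edge_irrefl. Qed.

Definition cone : sgraph := SGraph cone_edge_sym cone_edge_irrefl.

Lemma card_cone : #|cone| = #|G|.+1.
Proof. exact: card_option. Qed.

Lemma colorable_cone k : colorable cone k.+1 = colorable G k.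
Proof.
apply/colorableP/colorableP => [[c ck cP]|[c ck cP]]; last first.
  exists (fun x : cone => if x is Some u then c u else k) => [[u|]|[u|] [v|]] //=.
  - by rewrite ltnW ?ltnS.
  - exact: cP.
  - by rewrite ltn_eqF ?ck.
  - by rewrite gtn_eqF ?ck.
have apex u : c (Some u) != c None by apply: cP.
(* No vertex of [G] has the colour of the apex, so that colour can replace the top colour [k]. *)
exists (fun u => if c (Some u) == k then c None else c (Some u)) => [u|u v uv].
  by have := apex u; have := ck None; have := ck (Some u); case: ifPn; lia.
have := cP (Some u) (Some v) uv; have := apex u; have := apex v.
by do 2![case: ifPn]; lia.
Qed.

(** After deletion of a vertex [v] of [G], a [t]-colouring of [G - v] leaves colour [t] for the
    apex. After deletion of the apex, any [t.+1]-colouring of [G] will do. *)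
Lemma critical_cone t : critical t.+1 G -> critical t.+2 cone.
Proof.
case=> chiG chi_del; have := leqnn t.+1; rewrite -{1}chiG => Gt.
apply: criticalI => [||[v|]].
- by rewrite colorable_cone -chromatic_number_leq chiG ltnn.
- by rewrite colorable_cone -chromatic_number_leq.
- have: colorable (delete_vertex v) t by rewrite -chromatic_number_leq chi_del.
  case/colorable_deleteP=> c ck cP; apply/colorable_deleteP.
  have SomeE (u : G) : (Some u != Some v :> cone) = (u != v) by [].
  exists (fun x : cone => if x is Some u then c u else t) => [[u|]|[x|] [y|]] //=.
  + by rewrite SomeE => /ck/ltnW.
  + by rewrite !SomeE; apply: cP.
  + by rewrite SomeE => xv _ _; rewrite ltn_eqF ?ck.
  + by rewrite SomeE => _ yv _; rewrite gtn_eqF ?ck.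
- move: Gt; rewrite chromatic_number_leq => /colorableP[c ck cP].
  apply/colorable_deleteP.
  by exists (fun x : cone => if x is Some u then c u else 0) =>
    [[u|]|[x|] [y|]] //= _ _; apply: cP.
Qed.

(** The apex joins every bag. *)
Lemma layout_cone w : interval_layout G w -> interval_layout cone w.+1.
Proof.
case=> n [B [B_v B_e B_conv B_card]].
pose B' t : {set cone} := None |: Some @: B t.
have SomeB' t u : (Some u \in B' t) = (u \in B t).
  by rewrite !inE /= mem_imset //; apply: Some_inj.
have NoneB' t : None \in B' t by rewrite !inE.
exists n, B'; split=> [[v|]|[u|] [v|]|[v|] i j l|t] //=.
- by have [t tn vt] := B_v v; exists t => //; rewrite SomeB'.
- by exists 0.
- by move=> uv; have [t tn uvt] := B_e u v uv; exists t => //; rewrite !SomeB'.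
- by have [t tn vt] := B_v u; exists t => //; rewrite SomeB' vt NoneB'.
- by have [t tn vt] := B_v v; exists t => //; rewrite SomeB' vt NoneB'.
- by rewrite !SomeB'; apply: B_conv.
- rewrite cardsU1 card_imset; last exact: Some_inj.
  by rewrite -add1n; apply: leq_add (leq_b1 _) (B_card t).
Qed.

End Cone.

(** * Odd cycles *)

Section Cycle.
Variable n : nat.

(** With [n.+3] vertices the cycle is never degenerate, and it is odd exactly when [n] is even. *)
Definition cycle_edge : rel 'I_n.+3 := fun i j =>
  [|| i.+1 == j, j.+1 == i, (i == 0 :> nat) && (j == n.+2 :> nat)
    | (j == 0 :> nat) && (i == n.+2 :> nat)].

Fact cycle_edge_sym : symmetric cycle_edge.
Proof. by move=> i j; rewrite /cycle_edge; lia. Qed.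

Fact cycle_edge_irrefl : irreflexive cycle_edge.
Proof. by move=> i; rewrite /cycle_edge; lia. Qed.

Definition cycle_graph : sgraph := SGraph cycle_edge_sym cycle_edge_irrefl.

(** Two colours must alternate from vertex 0 on, so the adjacent vertices 0 and [n.+2] agree when
    [n] is even. *)
Lemma odd_cycle_not_colorable : ~~ odd n -> ~~ colorable cycle_graph 2.
Proof.
move=> n_even; apply/negP => /colorableP[c c2 cP].
have parity i : i < n.+3 -> c (inord i) = (c ord0 + i) %% 2.
  elim: i => [_|i IHi lt_i].
    have -> : inord 0 = ord0 :> 'I_n.+3 by apply: val_inj; rewrite /= inordK.
    by have := c2 ord0; lia.
  have := cP (inord i) (inord i.+1); rewrite /= /cycle_edge.
  rewrite !inordK ?(ltnW lt_i) // eqxx => /(_ isT).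
  by have := c2 (inord i.+1); have := IHi (ltnW lt_i); lia.
have := cP ord0 (inord n.+2); rewrite /= /cycle_edge /= inordK // eqxx orbT.
rewrite parity // => /(_ isT).
by have := c2 ord0; lia.
Qed.

Lemma odd_cycle_critical : ~~ odd n -> critical 3 cycle_graph.
Proof.
move=> n_even; have del (v : cycle_graph) : colorable (delete_vertex v) 2.
  apply/colorable_deleteP.
  (* Colours alternate along the path left by [v]. Shifting the parity beyond [v] separates the even
     vertices 0 and [n.+2], and the shift occurs only where the path is cut. *)
  exists (fun i : cycle_graph => odd (i + (val v < val i))) => [i _|i j].
    by case: (odd _).
  move: i j v => [i i_lt] [j j_lt] [v v_lt].
  rewrite -!val_eqE /= /cycle_edge /= => iv jv ij.
  by case: (ltnP v i); case: (ltnP v j); lia.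
apply: criticalI => //; first exact: odd_cycle_not_colorable.
exact: colorable_undelete (del ord0).
Qed.

(** Vertex 0 lies in every bag, and the remaining path is covered by its consecutive pairs [t.+1],
    [t.+2]. *)
Lemma cycle_layout : interval_layout cycle_graph 2.
Proof.
pose B t := [set i : cycle_graph |
  [|| val i == 0, val i == t.+1 | val i == t.+2]].
exists n, B; split=> [v|u v|v i j l|t].
(* Bag [v.-2] has [v] as its last entry if [v] is at least 2; truncation sends vertices 0 and 1 to
   bag 0, which contains both. For an edge the larger end determines the bag in the same way. *)
- by exists (val v).-2; rewrite ?inE /=; have := ltn_ord v; rewrite /=; lia.
- rewrite /= /cycle_edge => uv; exists (maxn u v).-2; rewrite ?inE /=.
    by have := ltn_ord u; have := ltn_ord v; rewrite /=; lia.
  by have := ltn_ord u; have := ltn_ord v; rewrite /=; lia.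
- by rewrite !inE /=; lia.
- have sub : B t \subset [set ord0; inord t.+1; inord t.+2].
    apply/subsetP => i; rewrite !inE => /or3P[] /eqP iE.
    + by rewrite -val_eqE /= iE.
    + by rewrite -iE inord_val eqxx orbT.
    + by rewrite -iE inord_val eqxx !orbT.
  apply: leq_trans (subset_leq_card sub) _.
  by rewrite setUC cardsU1 cards2; case: (_ \notin _); case: (_ != _).
Qed.

End Cycle.

(** * Iterated cones over odd cycles, and the theorem *)

Lemma odd_wheel_critical k m :
  critical m.+3 (iter m cone (cycle_graph k.*2)) /\
  interval_layout (iter m cone (cycle_graph k.*2)) m.+2.
Proof.
elim: m => [|m [IHc IHl]] /=.
  by split; [apply: odd_cycle_critical; rewrite odd_double | apply: cycle_layout].
by split; [apply: critical_cone | apply: layout_cone].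
Qed.

Theorem theorem6p1 (r : nat) (hr : 2 <= r) :
  exists H : sgraph -> Prop,
    (forall G : sgraph, H G ->
       [/\ critical r.+1 G, pathwidth G = r & treewidth G = r]) /\
    (forall s : nat, 0 < s ->
       exists G : sgraph, H G /\ s <= #|G| <= s + r).
Proof.
(* The family consists of all graphs with the required properties, so only the condition on orders
   calls for witnesses. *)
exists (fun G => [/\ critical r.+1 G, pathwidth G = r & treewidth G = r]).
split=> // s s_gt0; case: r hr => [|[|m]] // _.
(* Here [r] is [m.+2] and the witness has [m + k.*2.+3] vertices. As [k.*2] is [s - 1] or [s - 2],
   the order is [s + r] or [s + r - 1]. *)
pose k := s.-1./2; have [critG layG] := odd_wheel_critical k m.
exists (iter m cone (cycle_graph k.*2)); split.
  (* Both widths are squeezed by [r + 1 = chi <= tw + 1 <= pw + 1 <= r + 1]. *)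
  have [chiG _] := critG.
  have := chromatic_number_treewidth (iter m cone (cycle_graph k.*2)).
  have := treewidth_pathwidth (iter m cone (cycle_graph k.*2)).
  have := pathwidth_layout layG; rewrite chiG => pw tw chi.
  by split=> //; lia.
have -> : #|iter m cone (cycle_graph k.*2)| = m + k.*2.+3.
  by elim: m {critG layG} => [|m IHm] /=; rewrite ?card_ord // card_cone IHm.
by rewrite /k; lia.
Qed.
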